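(* Let $n$ be a positive integer and $k$ an integer with $n/3 + \sqrt{2n \ln 2} \le k \le n/2$. If $M_{k-1} \le m \le M_k$, then every family $\mathcal{F}$ of $m$ subsets of $[n]$ which maximises the number of comparable pairs among all families of $m$ subsets of $[n]$ satisfies $\mathcal{H}_{k-1} \subseteq \mathcal{F} \subseteq \mathcal{H}_k$.
   Context: For $0 \le j \le n/2$, $\mathcal{H}_j = \{F \subseteq [n]: |F| \le j\} \cup \{F \subseteq [n] : |F| \ge n-j\}$ and $M_j = |\mathcal{H}_j| = 2\sum_{i \le j}\binom{n}{i}$. A comparable pair in $\mathcal{F}$ is an unordered pair of distinct sets $A,B\in\mathcal{F}$ with $A\subseteq B$ or $B \subseteq A$. $\ln$ is the natural logarithm. *)

(* Defs.v *)
From mathcomp Require Import all_boot.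

Set Implicit Arguments.
Unset Strict Implicit.
Unset Printing Implicit Defensive.

(* Subsets of [n] are elements of {set 'I_n}, and families of subsets of [n]
   are elements of {set {set 'I_n}}. *)

(* Meant for 0 <= j <= n / 2; in this range n - j is the usual difference. *)
Definition calH (n j : nat) : {set {set 'I_n}} :=
  [set A : {set 'I_n} | #|A| <= j] :|: [set A : {set 'I_n} | n - j <= #|A|].

(* This is 2 * \sum_(i < j.+1) 'C(n, i) as long as j.*2 < n; if j.*2 = n the
   two halves of calH n j share the middle layer, and the cardinal is 2 ^ n. *)
Definition M (n j : nat) : nat := #|calH n j|.

Definition comparable_sets (n : nat) (A B : {set 'I_n}) : bool :=
  (A != B) && ((A \subset B) || (B \subset A)).

(* The unordered pair of A and B is the two-element set [set A; B]. *)
Definition comparable_pairs (n : nat) (F : {set {set 'I_n}}) :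
    {set {set {set 'I_n}}} :=
  [set [set A; B] | A in F, B in F & comparable_sets A B].

Definition maximises_comparable_pairs (n m : nat) (F : {set {set 'I_n}}) :
    Prop :=
  #|F| = m /\
  forall G : {set {set 'I_n}}, #|G| = m ->
    #|comparable_pairs G| <= #|comparable_pairs F|.

(* Main.v *)
(** Let H_j = calH n j, and let deg K A be the number of sets of K comparable
    to A. A set outside H_(k-1) has degree at most 2^k + 2^(n-k) - 2 in the whole
    cube. Since 3k - n >= 3 sqrt n, Chebyshev's inequality for binomial sums shows
    that most supersets of a set of size about k already lie in H_(k-3). Hence
    deg H_(k-3) A exceeds this bound for A in H_(k-1), and exceeds twice this
    bound for A in H_(k-3).
    Exchanging the whole set Y of sets of H_(k-3) missing from F for sets of F
    outside H_(k-1) forces Y to be empty: the degrees in H_(k-3) count the pairs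
    inside Y twice, and the factor 2 absorbs this. Once H_(k-3) is contained in F,
    exchanging one set for another gives first that F contains H_(k-1), then
    that F is contained in H_k. *)
Require Import Defs.
From mathcomp Require Import all_boot all_order all_algebra.
From mathcomp Require Import zify ring lra.
From mathcomp Require Import reals exp.

Set Implicit Arguments.
Unset Strict Implicit.
Unset Printing Implicit Defensive.

Import Order.TTheory GRing.Theory Num.Theory.

(** * Binomial sums and Chebyshev's inequality *)

Definition binsum (N t : nat) : nat := \sum_(i < t.+1) 'C(N, i).

Lemma leq_binsum N N' t : N <= N' -> binsum N t <= binsum N' t.
Proof. by move=> le_NN'; apply: leq_sum => i _; apply: leq_bin2l. Qed.

Lemma binsum_full N : binsum N N = 2 ^ N.
Proof.
rewrite (expnDn 1 1 N); apply: eq_bigr => i _.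
by rewrite !exp1n !muln1.
Qed.

(** Pascal's rule followed by an index shift; this is the induction step for the second moment. *)
Lemma sum_bin_pascal N (g : nat -> int) :
  (\sum_(i < N.+2) 'C(N.+1, i)%:Z * g i =
   \sum_(i < N.+1) 'C(N, i)%:Z * (g i + g i.+1))%R.
Proof.
rewrite big_ord_recl bin0 mul1r.
under eq_bigr => i _ do rewrite lift0 binS PoszD mulrDl.
rewrite big_split /= addrA.
under [in RHS]eq_bigr => i _ do rewrite mulrDr.
rewrite [in RHS]big_split /=; congr (_ + _)%R.
rewrite big_ord_recr /= bin_small // mul0r addr0.
by rewrite [RHS]big_ord_recl bin0 mul1r; congr (_ + _)%R; apply: eq_bigr => i _.
Qed.

(* The free shift c makes the induction on N go through; c = N gives the
   variance. *)
Lemma sum_bin_sqr N (c : int) :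
  (\sum_(i < N.+1) 'C(N, i)%:Z * (c - 2 * i%:Z) ^+ 2 =
   (2 ^ N)%N%:Z * ((c - N%:Z) ^+ 2 + N%:Z))%R.
Proof.
elim: N c => [|N IHN] c.
  by rewrite big_ord_recl big_ord0 bin0 /= addr0; ring.
rewrite (sum_bin_pascal N (fun i => (c - 2 * i%:Z) ^+ 2)%R).
under eq_bigr => i _ do rewrite mulrDr.
rewrite big_split /= IHN.
have shift i : (c - 2 * i.+1%:Z = (c - 2) - 2 * i%:Z)%R by lia.
under eq_bigr => i _ do rewrite shift.
by rewrite IHN expnS PoszM -(addn1 N) PoszD; ring.
Qed.

(* Chebyshev's inequality, using both symmetric tails. *)
Lemma binsum_tail N t (u := 2 * t.+1 - N) : t <= N -> N < 2 * t.+1 ->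
  u ^ 2 * (2 * 2 ^ N) <= N * 2 ^ N + u ^ 2 * (2 * binsum N t).
Proof.
move=> le_tN lt_N2t.
have defS : binsum N t = \sum_(i < N.+1) 'C(N, i) * (i <= t).
  rewrite /binsum (big_ord_widen N.+1) // [LHS]big_mkcond /=.
  by apply: eq_bigr => i _; rewrite ltnS; case: leqP; rewrite ?muln1 ?muln0.
have defS' : binsum N t = \sum_(i < N.+1) 'C(N, i) * (N - i <= t).
  rewrite defS (reindex_inj rev_ord_inj) /=; apply: eq_bigr => i _.
  by rewrite subSS bin_sub // -ltnS.
have var : \sum_(i < N.+1) 'C(N, i) * `|(N%:Z - 2 * i%:Z)%R|%N ^ 2 = N * 2 ^ N.
  apply/eqP; rewrite -eqz_nat; apply/eqP; have := sum_bin_sqr N N%:Z.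
  rewrite subrr expr0n add0r mulrC PoszM => <-.
  rewrite (big_morph Posz PoszD (erefl _)).
  by apply: eq_bigr => i _; rewrite PoszM; congr (_ * _)%R; lia.
have full : \sum_(i < N.+1) 'C(N, i) = 2 ^ N by rewrite -binsum_full.
have -> : 2 * binsum N t =
    \sum_(i < N.+1) 'C(N, i) * ((i <= t) + (N - i <= t)).
  rewrite mul2n -addnn {1}defS defS' -big_split /=.
  by apply: eq_bigr => i _; rewrite mulnDr.
rewrite -var -full !big_distrr -big_split /=.
apply: leq_sum => i _; have le_iN : i <= N by rewrite -ltnS.
(* Termwise form: as [N < 2 * t.+1], at most one of the two indicators vanishes, and then [i] and
   [N - i] differ by at least [u]. *)
have key : u ^ 2 * 2 <=
  `|(N%:Z - 2 * i%:Z)%R|%N ^ 2 + u ^ 2 * ((i <= t) + (N - i <= t)).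
  have le_u : (t < i) || (t < N - i) -> u <= `|(N%:Z - 2 * i%:Z)%R|%N.
    by rewrite /u; lia.
  move: le_u; rewrite !ltnNge -negb_and.
  case: (leqP i t) => h1; case: (leqP (N - i) t) => h2 //= le_u.
  - exact: leq_addl.
  - by rewrite addn0 muln1 mulnC mul2n -addnn leq_add2r leq_sqr le_u.
  - by rewrite add0n muln1 mulnC mul2n -addnn leq_add2r leq_sqr le_u.
  - by exfalso; lia.
by have := leq_mul (leqnn 'C(N, i)) key; lia.
Qed.

(** * Counting small subsets and large supersets *)

Lemma leq_card_ord n (A : {set 'I_n}) : #|A| <= n.
Proof. by rewrite -[leqRHS]card_ord max_card. Qed.

Lemma card_small_subsets (T : finType) (A : {set T}) t :
  #|[set B : {set T} | (B \subset A) && (#|B| <= t)]| = binsum #|A| t.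
Proof.
elim: t => [|t IHt].
  rewrite /binsum big_ord_recl big_ord0 addn0 -cards_draws.
  by apply: eq_card => B; rewrite !inE leqn0.
rewrite /binsum big_ord_recr /= -/(binsum _ _) -IHt -cards_draws -cardsUI.
rewrite [X in _ = _ + X]eq_card0 ?addn0; last first.
  move=> B; rewrite !inE; case: eqVneq; rewrite ?andbF // => ->.
  by rewrite ltnn !andbF.
by apply: eq_card => B; rewrite !inE -andb_orr leq_eqVlt orbC ltnS.
Qed.

(** Complementation carries supersets of [A] to subsets of [~: A]. *)
Lemma card_large_supersets n (A : {set 'I_n}) t :
  #|[set B : {set 'I_n} | (A \subset B) && (n - t <= #|B|)]| =
  binsum (n - #|A|) t.
Proof.
have cardC (B : {set 'I_n}) : #|~: B| = n - #|B|.
  by rewrite cardsCs setCK card_ord.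
rewrite -cardC -card_small_subsets -(card_imset _ (inv_inj (@setCK _))).
apply: eq_card => B; rewrite -[B]setCK (mem_imset _ _ (inv_inj (@setCK _))).
rewrite !inE !setCK -subsetC cardC; congr (_ && _).
by have := leq_card_ord B; lia.
Qed.

Lemma big_setU_disjoint (T : finType) (A B : {set T}) (F : T -> nat) :
  [disjoint A & B] ->
  \sum_(i in A :|: B) F i = \sum_(i in A) F i + \sum_(i in B) F i.
Proof.
by move=> dAB; rewrite -bigU //; apply: eq_bigl => i; rewrite !inE.
Qed.

(** * Degrees in the comparability graph *)

Section Degree.
Variable n : nat.
Implicit Types (A B C : {set 'I_n}) (F K X Y : {set {set 'I_n}}).

(** A sum of booleans rather than a cardinal, so that degrees add over disjoint families and double
    sums can be exchanged. *)
Definition deg K A : nat := \sum_(B in K) comparable_sets A B.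

Lemma comparable_setsC A B : comparable_sets A B = comparable_sets B A.
Proof. by rewrite /comparable_sets eq_sym orbC. Qed.

Lemma deg_card K A : deg K A = #|[set B in K | comparable_sets A B]|.
Proof.
rewrite /deg -sum1_card big_mkcond /= [RHS]big_mkcond /=.
apply: eq_bigr => B _; rewrite inE.
by case: (B \in K) => //=; case: comparable_sets.
Qed.

Lemma leq_deg K K' A : K \subset K' -> deg K A <= deg K' A.
Proof.
move=> sKK'; rewrite !deg_card; apply: subset_leq_card.
by apply/subsetP => B; rewrite !inE => /andP[/(subsetP sKK')-> ->].
Qed.

Lemma degU K K' A : [disjoint K & K'] -> deg (K :|: K') A = deg K A + deg K' A.
Proof. by move=> dKK'; exact: big_setU_disjoint. Qed.

Lemma sum_deg_sym K K' : \sum_(A in K) deg K' A = \sum_(A in K') deg K A.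
Proof.
rewrite exchange_big; apply: eq_bigr => B _; apply: eq_bigr => A _.
by rewrite comparable_setsC.
Qed.

Lemma sum_degU K K' : [disjoint K & K'] ->
  \sum_(A in K :|: K') deg (K :|: K') A =
  \sum_(A in K) deg K A + \sum_(A in K') deg K' A + 2 * \sum_(A in K') deg K A.
Proof.
move=> dKK'; under eq_bigr => A _ do rewrite degU //.
rewrite big_split /= !big_setU_disjoint //= (sum_deg_sym K K'); ring.
Qed.

(** Handshake identity: each unordered comparable pair is the image under [h] of exactly two ordered
    ones. *)
Lemma card_comparable_pairs F :
  2 * #|comparable_pairs F| = \sum_(A in F) deg F A.
Proof.
pose Q := [set p | [&& p.1 \in F, p.2 \in F & comparable_sets p.1 p.2]].
pose h (p : {set 'I_n} * {set 'I_n}) := [set p.1; p.2].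
have -> : comparable_pairs F = h @: Q.
  apply/setP => E; apply/imset2P/imsetP => [[A B AF]|[[A B]]].
    rewrite inE => /andP[BF cAB] ->; exists (A, B) => //.
    by rewrite inE /= AF BF cAB.
  rewrite inE /= => /and3P[AF BF cAB] ->; exists A B => //.
  by rewrite inE BF cAB.
transitivity #|Q|; last first.
  rewrite -sum1_card /deg pair_big_dep /= big_mkcond [RHS]big_mkcond /=.
  apply: eq_bigr => -[A B] _; rewrite inE /=.
  by case: (A \in F); case: (B \in F) => //=; case: comparable_sets.
rewrite -[RHS]sum1_card (partition_big_imset h) /= mulnC -sum_nat_const.
apply: eq_bigr => E /imsetP[[A B] QAB ->].
have [AF BF cAB] : [/\ A \in F, B \in F & comparable_sets A B].
  by apply/and3P; move: QAB; rewrite inE.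
have /andP[neqAB _] := cAB.
rewrite sum1dep_card -[LHS]/(true.+1) -neqAB.
have -> : (A != B).+1 = #|[set (A, B); (B, A)]|.
  by rewrite cards2 xpair_eqE negb_and [B == A]eq_sym orbb.
apply: eq_card => -[C D]; rewrite !inE /= !xpair_eqE.
apply/orP/andP => [[/andP[/eqP-> /eqP->]|/andP[/eqP-> /eqP->]]|[/and3P[_ _]]].
- by rewrite AF BF cAB.
- by rewrite AF BF comparable_setsC cAB /h /= setUC.
- rewrite /comparable_sets => /andP[neqCD _] /eqP defE.
  have : C \in h (A, B) by rewrite -defE !inE eqxx.
  have : D \in h (A, B) by rewrite -defE !inE eqxx orbT.
  rewrite !inE => /orP[] /eqP eqD /orP[] /eqP eqC; move: neqCD.
  + by rewrite eqC eqD eqxx.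
  + by rewrite eqC eqD !eqxx; right.
  + by rewrite eqC eqD !eqxx; left.
  + by rewrite eqC eqD eqxx.
Qed.

(** Compare [F] with the family in which [Y] replaces [X]: pairs inside [F :\: X] cancel. The gain
    is bounded below through the kept part [K]; on the right, pairs inside [X] are counted more
    often than needed, which only weakens the bound. *)
Lemma maximiser_swap m F K X Y :
  maximises_comparable_pairs m F -> X \subset F -> [disjoint Y & F] ->
  #|X| = #|Y| -> K \subset F :\: X ->
  \sum_(A in Y) deg Y A + 2 * \sum_(A in Y) deg K A <=
  2 * \sum_(B in X) deg setT B.
Proof.
move=> [Fm Fmax] sXF dYF eqXY sKF.
have dXF : [disjoint F :\: X & X].
  by rewrite disjoints_subset; apply/subsetP => A; rewrite !inE => /andP[].
have dYF' : [disjoint F :\: X & Y].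
  rewrite disjoint_sym; apply: disjointWr dYF; exact: subsetDl.
have defF : F = (F :\: X) :|: X.
  apply/setP => A; rewrite !inE.
  by case: (boolP (A \in X)) => [/(subsetP sXF)->|]; rewrite ?orbT ?orbF.
have := Fmax ((F :\: X) :|: Y).
rewrite cardsU disjoint_setI0 // cards0 subn0 -eqXY cardsDS //.
rewrite subnK ?(subset_leq_card sXF) // => /(_ Fm).
rewrite -(@leq_pmul2l 2) // !card_comparable_pairs [in X in _ <= X]defF.
rewrite !sum_degU //.
have : \sum_(A in Y) deg K A <= \sum_(A in Y) deg (F :\: X) A.
  by apply: leq_sum => A _; apply: leq_deg.
have : \sum_(B in X) deg X B + \sum_(B in X) deg (F :\: X) B <=
    \sum_(B in X) deg setT B.
  rewrite -big_split; apply: leq_sum => B _ /=; rewrite addnC -degU //.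
  exact/leq_deg/subsetT.
lia.
Qed.

Lemma maximiser_swap1 m F K A B :
  maximises_comparable_pairs m F -> A \notin F -> B \in F -> B \notin K ->
  K \subset F -> deg K A <= deg setT B.
Proof.
move=> Fmax AF BF BK sKF.
have := @maximiser_swap m F K [set B] [set A] Fmax.
rewrite sub1set disjoints1 !cards1 !big_set1 subsetD1 BF AF sKF BK.
by move=> /(_ isT isT erefl isT); lia.
Qed.

(** Large supersets and small subsets of [A] lie in [calH n t], and only [A] can be of both kinds.
    It then counts twice on the left but not in its own degree, whence the correction 2. *)
Lemma binsum_deg_calH A t :
  binsum (n - #|A|) t + binsum #|A| t <=
  deg (calH n t) A + 2 * (A \in calH n t).
Proof.
rewrite -card_large_supersets -card_small_subsets -cardsUI deg_card.
set U := [set B : {set 'I_n} | (A \subset B) && _].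
set D := [set B : {set 'I_n} | _].
have memUD B : (B \in U) || (B \in D) -> B \in calH n t.
  by rewrite !inE => /orP[] /andP[_ ->]; rewrite ?orbT.
have sUD1 : U :&: D \subset if A \in calH n t then [set A] else set0.
  apply/subsetP => B /setIP[BU BD].
  have eqBA : B = A.
    apply/eqP; rewrite eqEsubset; move: BU BD.
    by rewrite !inE => /andP[-> _] /andP[-> _].
  by rewrite -eqBA memUD ?BU // set11.
have sUD : U :|: D \subset [set B in calH n t | comparable_sets A B] :|:
    (if A \in calH n t then [set A] else set0).
  apply/subsetP => B /setUP/orP BUD.
  rewrite inE; case: (eqVneq A B) => [->|neqAB].
    by rewrite memUD // set11 orbT.
  rewrite inE (memUD B) // /comparable_sets neqAB /=; apply/orP; left.
  by move: BUD; rewrite !inE => /orP[] /andP[-> _]; rewrite ?orbT.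
have := leq_add (leq_trans (subset_leq_card sUD) (leq_card_setU _ _))
  (subset_leq_card sUD1).
by case: (A \in calH n t); rewrite ?cards1 ?cards0 -addnA.
Qed.

(** [B] is both a subset and a superset of itself, but not comparable to itself in the strict sense
    of [deg]: hence the 2. *)
Lemma deg_setT_le B : deg setT B + 2 <= 2 ^ #|B| + 2 ^ (n - #|B|).
Proof.
rewrite deg_card -!binsum_full -[X in _ <= _ + X]card_large_supersets.
rewrite -card_small_subsets -cardsUI.
set D := [set C : {set 'I_n} | _]; set U := [set C : {set 'I_n} | _].
have le_Bn := leq_card_ord B.
have BD : B \in D by rewrite inE subxx leqnn.
have BU : B \in U by rewrite inE subxx subKn ?leqnn.
have sB : [set B] \subset D :&: U by rewrite sub1set inE BD BU.
have sC : [set C in setT | comparable_sets B C] \subset (D :|: U) :\ B.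
  apply/subsetP => C; rewrite !inE /= => /andP[neqBC sBC].
  rewrite eq_sym neqBC /= subKn //.
  by case/orP: sBC => sBC; rewrite sBC (subset_leq_card sBC) ?orbT.
have := subset_leq_card sC; have := subset_leq_card sB.
have := cardsD1 B (D :|: U); rewrite in_setU BD cards1 /= => -> lt0 leC.
by rewrite -[2]/(1 + 1) addnA; apply: leq_add lt0; rewrite addnC leq_add2l.
Qed.

(** Convexity of 2^x + 2^(n-x): with |B| = j + p and n - |B| = j + q, the claim reduces to (2^p -
    1)(2^q - 1) >= 0. *)
Lemma deg_setT_middle B j : j <= #|B| <= n - j ->
  deg setT B + 2 <= 2 ^ j + 2 ^ (n - j).
Proof.
move=> /andP[jB Bj]; apply: leq_trans (deg_setT_le B) _.
have [p eqp] : exists p, #|B| = j + p by exists (#|B| - j); rewrite subnKC.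
have [q eqq] : exists q, n - #|B| = j + q by exists (n - #|B| - j); lia.
have -> : n - j = j + p + q by move: (leq_card_ord B); lia.
rewrite eqq eqp !expnD.
have pow_gt0 e : 0 < 2 ^ e by rewrite expn_gt0.
move: (pow_gt0 j) (pow_gt0 p) (pow_gt0 q).
by move: (2 ^ j) (2 ^ p) (2 ^ q) => a [//|b] [//|c] _ _ _;
  rewrite !mulnS mulnDl; lia.
Qed.

End Degree.

(** For c > 0 this says, free of division, that [binsum N t] exceeds the fraction 1 - 1/(2c) of 2^N;
    symmetry of the tails gives the 2. *)
Lemma binsum_gt c N t (u := 2 * t.+1 - N) : t <= N -> N < 2 * t.+1 ->
  c * N < u ^ 2 -> (2 * c) * 2 ^ N < 2 ^ N + 2 * c * binsum N t.
Proof.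
move=> le_tN lt_N2t lt_cN; have := binsum_tail le_tN lt_N2t; rewrite -/u.
have u_gt0 : 0 < u ^ 2 by apply: leq_ltn_trans lt_cN.
have pow_gt0 : 0 < 2 ^ N by rewrite expn_gt0.
case: c lt_cN => [|c] lt_cN h; first by rewrite !muln0 !mul0n addn0.
rewrite -(ltn_pmul2l u_gt0).
have h1 : c.+1 * (u ^ 2 * (2 * 2 ^ N)) <=
    c.+1 * (N * 2 ^ N + u ^ 2 * (2 * binsum N t)) by rewrite leq_mul2l h orbT.
have h2 : c.+1 * N * 2 ^ N < u ^ 2 * 2 ^ N by rewrite ltn_pmul2r.
apply: leq_ltn_trans (_ : c.+1 * (N * 2 ^ N + u ^ 2 * (2 * binsum N t)) < _).
  by apply: leq_trans h1; rewrite eq_leq //; ring.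
rewrite mulnDr [ltnRHS]mulnDr mulnA -addSn leq_add // eq_leq //; ring.
Qed.

Lemma exists_subset_card (T : finType) (A : {set T}) j :
  j <= #|A| -> exists2 B : {set T}, B \subset A & #|B| = j.
Proof.
move=> le_jA; have /card_gt0P[B] :
    0 < #|[set B : {set T} | (B \subset A) && (#|B| == j)]|.
  by rewrite cards_draws bin_gt0.
by rewrite inE => /andP[sBA /eqP cardB]; exists B.
Qed.

(** * Optimal families *)

Section Optimum.
Variables (n k m : nat) (F : {set {set 'I_n}}).
Hypothesis n_gt0 : 0 < n.
Hypothesis k_le : 2 * k <= n.
Hypothesis n_le : n <= 3 * k.
Hypothesis n_sqr : 9 * n <= (3 * k - n) ^ 2.
Hypothesis F_max : maximises_comparable_pairs m F.

Lemma exists_gap : exists2 e, 3 * k = n + (18 + e) & 9 * n <= (18 + e) ^ 2.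
Proof.
(* With d = 3k - n, [k_le] gives 2d <= n, so 18d <= 9n <= d^2, and d > 0 because n > 0. *)
have ge18 : 18 <= 3 * k - n by nia.
by exists (3 * k - n - 18); rewrite subnKC //; lia.
Qed.

Lemma leq_pow2 : 2 ^ k <= 2 ^ (n - k).
Proof. by rewrite leq_exp2l //; lia. Qed.

(** Up to complementation |A| <= k - 3. With c = 1, the supersets in the family number more than
    half of 2^(n-k+3), that is 4 * 2^(n-k), and 2^k <= 2^(n-k). *)
Lemma deg_extreme A : A \in calH n (k - 3) ->
  2 * (2 ^ k + 2 ^ (n - k)) < deg (calH n (k - 3)) A + 4.
Proof.
have [e eq_k sqr_e] := exists_gap.
have S_gt : 2 * 2 ^ (n - k + 3) <
    2 ^ (n - k + 3) + 2 * binsum (n - k + 3) (k - 3).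
  by apply: (@binsum_gt 1); nia.
move=> AL; have := binsum_deg_calH A (k - 3); rewrite AL muln1.
have le_An := leq_card_ord A.
have : binsum (n - k + 3) (k - 3) <=
    binsum (n - #|A|) (k - 3) + binsum #|A| (k - 3).
  move: AL; rewrite !inE => /orP[] le_A.
  - by apply: leq_trans (leq_addr _ _); apply: leq_binsum; lia.
  - by apply: leq_trans (leq_addl _ _); apply: leq_binsum; lia.
have := leq_pow2; move: S_gt; rewrite (expnD 2 (n - k) 3).
have : 0 < 2 ^ (n - k) by rewrite expn_gt0.
lia.
Qed.

(** With c = 8, one side contributes more than 15/8 of 2^(n-k), the other at least 2^(k-3) = 2^k /
    8. As 2^k <= 2^(n-k), the surplus 7/8 covers the rest of 2^k. *)
Lemma deg_core A : A \in calH n (k - 1) -> A \notin calH n (k - 3) ->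
  2 ^ k + 2 ^ (n - k) < deg (calH n (k - 3)) A + 2.
Proof.
have [e eq_k sqr_e] := exists_gap.
have S_gt : 16 * 2 ^ (n - k + 1) <
    2 ^ (n - k + 1) + 16 * binsum (n - k + 1) (k - 3).
  by apply: (@binsum_gt 8); nia.
move=> AH AL; have := binsum_deg_calH A (k - 3).
rewrite (negPf AL) muln0 addn0.
have le_An := leq_card_ord A.
have : binsum (n - k + 1) (k - 3) + binsum (k - 3) (k - 3) <=
    binsum (n - #|A|) (k - 3) + binsum #|A| (k - 3).
  move: AH AL; rewrite !inE => /orP[] le_A /norP[lt1 lt2].
  - by apply: leq_add; apply: leq_binsum; lia.
  - by rewrite addnC; apply: leq_add; apply: leq_binsum; lia.
have := leq_pow2; move: S_gt; rewrite (expnD 2 (n - k) 1) binsum_full.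
have -> : 2 ^ k = 2 ^ (k - 3) * 2 ^ 3 by rewrite -expnD subnK //; lia.
lia.
Qed.

(** Sets outside [calH n k] have sizes from k + 1 to n - k - 1, so the bound to beat moves by one
    layer. Again c = 8 suffices, now with 2^(k+2) <= 2^(n-k). *)
Lemma deg_layer A :
  2 * k.+1 <= n -> A \in calH n k -> A \notin calH n (k - 1) ->
  2 ^ k.+1 + 2 ^ (n - k.+1) < deg (calH n (k - 1)) A + 2.
Proof.
have [e eq_k sqr_e] := exists_gap => lt_k.
have S_gt : 16 * 2 ^ (n - k) < 2 ^ (n - k) + 16 * binsum (n - k) (k - 1).
  by apply: (@binsum_gt 8); nia.
move=> AH AL; have := binsum_deg_calH A (k - 1).
rewrite (negPf AL) muln0 addn0.
have le_An := leq_card_ord A.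
have : binsum (n - k) (k - 1) + binsum (k - 1) (k - 1) <=
    binsum (n - #|A|) (k - 1) + binsum #|A| (k - 1).
  move: AH AL; rewrite !inE => /orP[] le_A /norP[lt1 lt2].
  - by apply: leq_add; apply: leq_binsum; lia.
  - by rewrite addnC; apply: leq_add; apply: leq_binsum; lia.
have : 2 ^ k.+2 <= 2 ^ (n - k) by rewrite leq_exp2l //; lia.
move: S_gt; rewrite binsum_full !expnS.
have -> : 2 ^ k = 2 * 2 ^ (k - 1) by rewrite -expnS; congr (2 ^ _); lia.
have -> : 2 ^ (n - k) = 2 * 2 ^ (n - k.+1).
  by rewrite -expnS; congr (2 ^ _); lia.
have : 0 < 2 ^ (k - 1) by rewrite expn_gt0.
lia.
Qed.

Lemma card_notin_calH j (B : {set 'I_n}) :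
  B \notin calH n j -> j.+1 <= #|B| <= n - j.+1.
Proof. by rewrite !inE => /norP[]; lia. Qed.

Lemma extreme_sub : #|calH n (k - 1)| <= m -> calH n (k - 3) \subset F.
Proof.
move=> le_Hm; set L := calH n (k - 3); set H := calH n (k - 1) in le_Hm *.
have [e eq_k sqr_e] := exists_gap.
have sLH : L \subset H.
  apply/subsetP => A; rewrite !inE => /orP[] le_A; apply/orP; [left|right]; lia.
rewrite -setD_eq0; set Y := L :\: F; apply: contraT => Yn0.
(* There is room for [X]: |F| = m >= |H| gives |F \ H| >= |H \ F| >= |Y|. *)
have [X sX eqXY] : exists2 X : {set {set 'I_n}},
    X \subset F :\: H & #|X| = #|Y|.
  apply: exists_subset_card; apply: leq_trans (subset_leq_card (setSD F sLH)) _.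
  have := cardsID F H; have := cardsID H F; rewrite setIC F_max.1; lia.
have /andP[sXF dXH] : (X \subset F) && [disjoint X & H] by rewrite -subsetD.
have dYF : [disjoint Y & F] by rewrite disjoints_subset subDset setUCr subsetT.
have sKF : L :&: F \subset F :\: X.
  rewrite subsetD subsetIr disjoint_sym; apply: disjointWr dXH.
  exact: subset_trans (subsetIl _ _) sLH.
have := maximiser_swap F_max sXF dYF eqXY sKF.
have : #|Y| * (2 * (2 ^ k + 2 ^ (n - k)) - 3) <= \sum_(A in Y) deg L A.
  rewrite -sum_nat_const; apply: leq_sum => A /setDP[AL _].
  by have := deg_extreme AL; rewrite -/L; lia.
have : \sum_(B in X) deg setT B <= #|X| * (2 ^ k + 2 ^ (n - k) - 2).
  rewrite -sum_nat_const; apply: leq_sum => B BX.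
  have /card_notin_calH/andP[le_kB le_Bk] : B \notin H.
    by rewrite (disjointFr dXH BX).
  suff /deg_setT_middle : k <= #|B| <= n - k by lia.
  by apply/andP; lia.
have -> : \sum_(A in Y) deg L A =
    \sum_(A in Y) deg Y A + \sum_(A in Y) deg (L :&: F) A.
  rewrite -big_split; apply: eq_bigr => A _ /=.
  rewrite addnC -degU ?setID // disjoint_sym.
  by apply: disjointWr dYF; exact: subsetIr.
rewrite eqXY.
(* With y = |Y| and z = 2^k + 2^(n-k), the contradiction is y(2z - 3) <= a + b <= a + 2b <= 2c <=
   2y(z - 2). *)
move: (\sum_(A in Y) deg Y A) (\sum_(A in Y) deg (L :&: F) A) => a b.
move: (\sum_(B in X) _) => c; rewrite -card_gt0 in Yn0.
have : 4 <= 2 ^ k + 2 ^ (n - k).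
  have := leq_pow2; have : 2 ^ 1 <= 2 ^ k by rewrite leq_exp2l //; lia.
  lia.
move: (2 ^ k + 2 ^ (n - k)) #|Y| Yn0 => z y y_gt0 z_ge; nia.
Qed.

Lemma calH_sub : #|calH n (k - 1)| <= m -> calH n (k - 1) \subset F.
Proof.
move=> le_Hm; have sLF := extreme_sub le_Hm; have [e eq_k _] := exists_gap.
apply/subsetP => A AH; apply: contraT => AF.
have [B BF BH] : exists2 B, B \in F & B \notin calH n (k - 1).
  apply/subsetPn; apply: contra AF => sFH.
  by have /eqP-> : F == calH n (k - 1) by rewrite eqEcard sFH (proj1 F_max).
have BL : B \notin calH n (k - 3).
  by move: BH; rewrite !inE; lia.
have AL : A \notin calH n (k - 3) by apply: contra AF => /(subsetP sLF).
have := maximiser_swap1 F_max AF BF BL sLF; have := deg_core AH AL.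
have /deg_setT_middle : k <= #|B| <= n - k by have := card_notin_calH BH; lia.
lia.
Qed.

Lemma sub_calH : #|calH n (k - 1)| <= m <= #|calH n k| -> F \subset calH n k.
Proof.
move=> /andP[le_Hm le_mH]; have sHF := calH_sub le_Hm.
have [e eq_k _] := exists_gap.
apply/subsetP => B BF; apply: contraT => BH.
have [A AH AF] : exists2 A, A \in calH n k & A \notin F.
  apply/subsetPn; apply: contra BH => sHkF.
  by have /eqP-> : calH n k == F by rewrite eqEcard sHkF (proj1 F_max).
have BH' : B \notin calH n (k - 1).
  by move: BH; rewrite !inE; lia.
have AH' : A \notin calH n (k - 1) by apply: contra AF => /(subsetP sHF).
(* The existence of [B] also yields the hypothesis [2 * k.+1 <= n] of [deg_layer]. *)
have kB := card_notin_calH BH.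
have := maximiser_swap1 F_max AF BF BH' sHF.
have := deg_setT_middle kB; have := deg_layer _ AH AH'.
lia.
Qed.

End Optimum.

(** * From the real bounds on k to integer inequalities *)

Lemma half_le_ln2 (R : realType) : (2^-1 <= ln 2 :> R)%R.
Proof.
(* ln(1 + x) <= x at x = -1/2. *)
have := @le_ln1Dx R (- 2^-1)%R.
rewrite (_ : 1 - 2^-1 = 2^-1)%R; last by lra.
by rewrite lnV ?posrE // => h; have := h ltac:(lra); lra.
Qed.

Local Open Scope ring_scope.

Theorem theorem1p7 (R : realType) (n k m : nat)
  (n_gt0 : (0 < n)%N)
  (k_ge : n%:R / 3 + Num.sqrt (2 * n%:R * ln 2) <= k%:R :> R)
  (k_le : k%:R <= n%:R / 2 :> R)
  (m_bounds : (M n k.-1 <= m <= M n k)%N)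
  (F : {set {set 'I_n}})
  (F_max : maximises_comparable_pairs m F) :
  calH n k.-1 \subset F /\ F \subset calH n k.
Proof.
have k_leN : (2 * k <= n)%N by rewrite -(ler_nat R) natrM; lra.
have sqrt_ge0 : 0 <= Num.sqrt (2 * n%:R * ln 2 : R) by exact: sqrtr_ge0.
(* This makes [3 * k - n] a true difference, so that [natrB] applies to it below. *)
have n_leN : (n <= 3 * k)%N by rewrite -(ler_nat R) natrM; lra.
(* Squaring 3k - n >= 3 sqrt(2n ln 2) and using ln 2 >= 1/2 removes the logarithm. *)
have n_sqr : (9 * n <= (3 * k - n) ^ 2)%N.
  rewrite -(ler_nat R) natrX natrB // !natrM.
  have ln2 := half_le_ln2 R; have n_ge0 : 0 <= n%:R :> R by exact: ler0n.
  have sqrE : Num.sqrt (2 * n%:R * ln 2 : R) ^+ 2 = 2 * n%:R * ln 2.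
    by rewrite sqr_sqrtr // mulr_ge0 ?mulr_ge0 //; lra.
  have n_le : n%:R <= 2 * n%:R * ln 2 :> R by nra.
  nra.
rewrite -subn1 in m_bounds *; split.
  by apply: (calH_sub n_gt0 k_leN n_leN n_sqr F_max); case/andP: m_bounds.
exact: (sub_calH n_gt0 k_leN n_leN n_sqr F_max m_bounds).
Qed.
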